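(* Let $V$ be a vertex operator algebra over $\mathbb{C}$ with a nondegenerate symmetric bilinear form $(\cdot,\cdot)$, and let $R$ be an integral VOA form of $V$, with $R_n := R\cap V_n$. Assume that, for some $d$, the (finitely generated) vertex operator algebra $V$ is generated over $\mathbb{C}$ by $\tilde R := R_0+R_1+\cdots+R_d$, and let $G$ be a finite subgroup of $\mathrm{Aut}(V)$ which leaves invariant the rational vector space spanned by $\tilde R$. Then there exists an integral VOA form $S$ of $V$ such that (a) $S\le R$ and, for all $n$, the index $|R_n : S_n|$ is finite, where $S_n := S\cap V_n$; (b) $S$ is $G$-invariant.
   Context: For a vertex operator algebra (VOA) $V=\bigoplus_n V_n$, $u_n$ denotes the $n$-th mode of $u\in V$ (coefficients of $Y(u,z)=\sum_n u_n z^{-n-1}$), $\mathbf 1$ is the vacuum and $\omega$ the Virasoro element. An integral form of a finite-dimensional complex vector space $U$ is the $\mathbb{Z}$-span of some $\mathbb{C}$-basis of $U$. Let $V$ be a VOA over $\mathbb{C}$ with a nondegenerate symmetric bilinear form $(\cdot,\cdot)$. An integral VOA form (IVOA) of $V$ is an additive subgroup $R$ of $V$ such that: $R$ is a vertex algebra over $\mathbb{Z}$ (i.e. $\mathbf 1\in R$ and $u_nv\in R$ for all $u,v\in R$, $n\in\mathbb{Z}$); there is a positive integer $s$ with $s\omega\in R$; for each $n$, $R_n:=R\cap V_n$ is an integral form of $V_n$; and $(R,R)\subseteq\mathbb{Q}$. *)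

(* Defs.v *)
From HB Require Import structures.
From mathcomp Require Import all_boot all_order all_algebra sesquilinear.
From mathcomp Require Import classical_sets functions cardinality fsbigop reals.
From mathcomp Require Export complex.

Set Implicit Arguments.
Unset Strict Implicit.
Unset Printing Implicit Defensive.

Import GRing.Theory.
Local Open Scope ring_scope.
Local Open Scope complex_scope.
Local Open Scope classical_set_scope.

(* The complex numbers are K[i], for K : realType.                            *)

(* The binomial coefficient "p choose i" for an arbitrary integer p:          *)
(* p (p - 1) ... (p - i + 1) / i!.                                            *)
Definition binomz (F : fieldType) (p : int) (i : nat) : F :=
  (\prod_(j < i) (p - j%:Z)%:~R) / i`!%:R.

Section Spans.
Variables (C : fieldType) (V : lmodType C).
Implicit Types (A U L : set V).

Definition is_subgroup A : Prop :=
  A 0 /\ forall u v, A u -> A v -> A (u - v).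

Definition is_subspace A : Prop :=
  A 0 /\ forall (a : C) u v, A u -> A v -> A (a *: u + v).

Definition is_basis U (k : nat) (b : 'I_k -> V) : Prop :=
  [/\ forall i, U (b i),
      forall v, U v -> exists a : 'I_k -> C, v = \sum_(i < k) a i *: b i
    & forall a : 'I_k -> C, \sum_(i < k) a i *: b i = 0 -> forall i, a i = 0].

Definition finite_dim U : Prop := exists k (b : 'I_k -> V), is_basis U b.

Definition int_span (k : nat) (b : 'I_k -> V) : set V :=
  [set v | exists m : 'I_k -> int, v = \sum_(i < k) b i *~ m i].

Definition integral_form U L : Prop :=
  exists k (b : 'I_k -> V), is_basis U b /\ L = int_span b.

Definition rat_span A : set V :=
  [set v | exists k (b : 'I_k -> V) (q : 'I_k -> rat),
     (forall i, A (b i)) /\ v = \sum_(i < k) ratr (q i) *: b i].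

(* The index |A : B| of an additive subgroup B of A is the number of cosets   *)
(* v + B with v in A.                                                         *)
Definition finite_index A B : Prop :=
  finite_set [set [set v + w | w in B] | v in A].

Definition nondegenerate_form (f : V -> V -> C) : Prop :=
  forall u, (forall v, f u v = 0) -> u = 0.

End Spans.

(* mode n u v is u_n v, so that Y(u, z) = \sum_n (mode n u) z^(-n-1).  The    *)
(* Jacobi identity is stated in its component form (the Borcherds identity).  *)
(* Sums over all of nat are finite-support sums: by mode_trunc only finitely  *)
(* many terms are nonzero.                                                    *)
Record voa (K : realType) := VOA {
  voa_sort :> lmodType K[i];
  grade : int -> set voa_sort;
  mode : int -> {bilinear voa_sort -> voa_sort -> voa_sort};
  vac : voa_sort;
  conf : voa_sort;
  ccharge : K[i];
  grade_subspace : forall n, is_subspace (grade n);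
  grade_direct : forall v : voa_sort, exists! x : int -> voa_sort,
    [/\ forall n, grade n (x n),
        finite_set [set n | x n <> 0]
      & v = \sum_(n \in [set: int]) x n];
  grade_findim : forall n, finite_dim (grade n);
  grade_bounded_below :
    exists N : int, forall n v, n < N -> grade n v -> v = 0;
  mode_trunc : forall u v : voa_sort,
    exists N : int, forall n, N <= n -> mode n u v = 0;
  grade_vac : grade 0 vac;
  mode_vac : forall n v, mode n vac v = if n == -1 then v else 0;
  mode_creation : forall n v, 0 <= n -> mode n v vac = 0;
  mode_creationN1 : forall v, mode (-1) v vac = v;
  borcherds : forall (p q r : int) (u v w : voa_sort),
    \sum_(i \in [set: nat])
       binomz K[i] p i *: mode (p + q - i%:Z) (mode (r + i%:Z) u v) w
    = \sum_(i \in [set: nat])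
       ((-1) ^+ i * binomz K[i] r i) *:
         (mode (p + r - i%:Z) u (mode (q + i%:Z) v w)
          - (-1) ^ r *: mode (q + r - i%:Z) v (mode (p + i%:Z) u w));
  grade_conf : grade 2 conf;
  (* L(n) = omega_(n+1) *)
  virasoro : forall (m n : int) v,
    mode (m + 1) conf (mode (n + 1) conf v)
    - mode (n + 1) conf (mode (m + 1) conf v)
    = (m - n)%:~R *: mode (m + n + 1) conf v
      + (if m + n == 0 then (m ^+ 3 - m)%:~R / 12%:R * ccharge else 0) *: v;
  L0_grade : forall n v, grade n v -> mode 1 conf v = n%:~R *: v;
  Lm1_derivative : forall n u v,
    mode n (mode 0 conf u) v = - n%:~R *: mode (n - 1) u v
}.

Arguments grade {K} _ n : rename.
Arguments mode {K _} n : rename.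

Section VOATheory.
Variables (K : realType) (V : voa K).
Implicit Types (A R W : set V) (G : set (V -> V)).

Definition mode_closed A : Prop :=
  forall n u v, A u -> A v -> A (mode n u v).

Definition generated_by A : Prop :=
  forall W, is_subspace W -> W (vac V) -> mode_closed W ->
    A `<=` W -> W = [set: V].

Record is_voa_aut (g : V -> V) : Prop := IsVoaAut {
  aut_linear : linear g;
  aut_bij : bijective g;
  aut_mode : forall n u v, g (mode n u v) = mode n (g u) (g v);
  aut_vac : g (vac V) = vac V;
  aut_conf : g (conf V) = conf V
}.

Record is_finite_aut_subgroup G : Prop := IsFiniteAutSubgroup {
  autg_aut : forall g, G g -> is_voa_aut g;
  autg_id : G id;
  autg_comp : forall g h, G g -> G h -> G (g \o h);
  autg_inv : forall g, G g -> exists h, [/\ G h, cancel g h & cancel h g];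
  autg_finite : finite_set G
}.

(* As G is a group, inclusion for every g in G is the same as equality.       *)
Definition invariant_under G A : Prop :=
  forall g, G g -> [set g v | v in A] `<=` A.

Definition graded_part R (n : int) : set V := R `&` grade V n.

Record is_ivoa (form : {symmetric V}) R : Prop := IsIvoa {
  ivoa_subgroup : is_subgroup R;
  ivoa_vac : R (vac V);
  ivoa_mode : mode_closed R;
  ivoa_conf : exists s : nat, (0 < s)%N /\ R (conf V *+ s);
  ivoa_int : forall n, integral_form (grade V n) (graded_part R n);
  ivoa_rat : forall u v, R u -> R v -> exists q : rat, form u v = ratr q
}.

(* R_0 + R_1 + ... + R_d *)
Definition low_part R (d : nat) : set V :=
  [set v | exists r : 'I_d.+1 -> V,
     (forall i : 'I_d.+1, graded_part R i%:Z (r i)) /\ v = \sum_i r i].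

End VOATheory.

(* Main.v *)
Require Import Defs.
From HB Require Import structures.
From mathcomp Require Import all_boot all_order all_algebra sesquilinear.
From mathcomp Require Import boolp classical_sets functions cardinality fsbigop reals.

Set Implicit Arguments.
Unset Strict Implicit.
Unset Printing Implicit Defensive.

Import GRing.Theory Num.Theory.
Local Open Scope ring_scope.
Local Open Scope classical_set_scope.

(** The form S is the largest G-stable subgroup of R, namely the intersection
    of the translates of R under G ([invariant_core]).  Since G fixes the vacuum
    and the conformal vector and respects all modes, S inherits from R
    everything that makes it an integral VOA form, except that each S_n must
    still have full rank in R_n.

    Full rank amounts to the rational span B of R being large enough: if g maps
    R_n into B for every g in G, then, as G is finite and R_n has finite rank, a
    single positive integer N satisfies N R_n <= S_n <= R_n
    ([graded_part_core_exponent]); hence S_n is free of the same rank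
    ([integral_form_sub]) and has finite index ([finite_index_sub]).

    To see that G maps R_n into B, let W be the set of all w with g w in B for
    every g in G.  It is a vertex algebra over the rationals inside B, and it
    contains R_0 + ... + R_d because G preserves the rational span of that
    group.  So the complex span of W is a vertex algebra that contains the
    generators of V, and is all of V.  Because W contains the conformal
    vector, which has a multiple in R, it is stable under L(0), and Lagrange interpolation in
    L(0), whose eigenvalues are integers, cuts out weight components with
    rational coefficients: so V_n is the complex span of the weight n part of W
    ([graded_part_span]).  Finally both W_n and R_n consist of vectors with
    rational coordinates in a basis of R_n, and a rational vector that is a
    complex combination of rational vectors is also a rational combination of
    them ([rational_descent]); hence R_n lies in W. *)

(** * Subgroups of finitely generated abelian groups *)

Lemma int_subgroup_principal (I : set int) :
  I 0 -> (forall m n, I m -> I n -> I (m - n)) ->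
  exists d, I d /\ forall m, I m -> exists q, m = d * q.
Proof.
move=> I0 IB.
have IN m : I m -> I (- m) by move=> Im; rewrite -sub0r; exact: IB.
have ID m n : I m -> I n -> I (m + n).
  by move=> Im In; rewrite -[n]opprK; exact/IB/IN.
have [[n [n0 In]]|noI] :=
  pselect (exists n : nat, (0 < n)%N /\ I n%:Z); last first.
  exists 0; split=> // m Im; exists 0; rewrite mulr0.
  case: m Im => [[|n]|n] Im //; case: noI; exists n.+1; split=> //.
  by have := IN _ Im; rewrite NegzE opprK.
have exI : exists n : nat, `[< (0 < n)%N /\ I n%:Z >] by exists n; apply/asboolP.
have [d /asboolP[d0 Id] dmin] := ex_minnP exI.
have IdM (q : nat) : I (d%:Z * q%:Z).
  elim: q => [|q IHq]; first by rewrite mulr0.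
  by rewrite -addn1 PoszD mulrDr mulr1; exact: ID.
have IdZ (q : int) : I (d%:Z * q).
  by case: q => q //; rewrite NegzE mulrN; apply: IN.
exists d%:Z; split=> // m Im; exists (m %/ d%:Z)%Z.
have Ir : I (m %% d%:Z)%Z.
  by rewrite /modz mulrC; exact: IB.
have dn0 : d%:Z != 0 by rewrite eqz_nat -lt0n.
have r0 := modz_ge0 m dn0.
have rd := ltz_mod m dn0.
move: r0 rd Ir (divz_eq m d%:Z); case: (m %% d%:Z)%Z => // -[|r] _ rd Ir.
  by rewrite addr0 mulrC.
have /dmin : `[< (0 < r.+1)%N /\ I r.+1%:Z >] by apply/asboolP.
by move: rd; rewrite /= ltz_nat ltnNge => /negP.
Qed.

Section Subgroups.
Variables (C : fieldType) (V : lmodType C).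
Implicit Types (A B L U : set V).

Lemma subgroupN A u : is_subgroup A -> A u -> A (- u).
Proof. by move=> [A0 AB] Au; rewrite -sub0r; exact: AB. Qed.

Lemma subgroupD A u v : is_subgroup A -> A u -> A v -> A (u + v).
Proof.
by move=> sA Au Av; rewrite -[v]opprK; apply: sA.2 => //; exact: subgroupN.
Qed.

Lemma subgroupMn A u n : is_subgroup A -> A u -> A (u *+ n).
Proof.
move=> sA Au; elim: n => [|n IHn]; first by rewrite mulr0n; case: sA.
by rewrite mulrS; exact: subgroupD.
Qed.

Lemma subgroupMz A u m : is_subgroup A -> A u -> A (u *~ m).
Proof.
move=> sA Au; case: m => n; first exact: (subgroupMn n sA Au).
by rewrite NegzE mulrNz; exact: (subgroupN sA (subgroupMn _ sA Au)).
Qed.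

Lemma subgroup_sum A (I : finType) (F : I -> V) :
  is_subgroup A -> (forall i, A (F i)) -> A (\sum_i F i).
Proof.
move=> sA AF; elim/big_rec : _ => [|i v _ Av]; first by case: sA.
exact: (subgroupD sA (AF i) Av).
Qed.

Lemma subgroupI A B : is_subgroup A -> is_subgroup B -> is_subgroup (A `&` B).
Proof.
by move=> [A0 AB] [B0 BB]; split=> // u v [Au Bu] [Av Bv]; split; auto.
Qed.

Lemma int_span_subgroup k (b : 'I_k -> V) : is_subgroup (int_span b).
Proof.
split=> [|u v [m ->] [n ->]].
  by exists (fun=> 0); rewrite big1 // => i _; rewrite mulr0z.
by exists (fun i => m i - n i); rewrite -sumrB; apply: eq_bigr => i _; rewrite mulrzBr.
Qed.

Lemma int_span_gen k (b : 'I_k -> V) i : int_span b (b i).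
Proof.
exists (fun j => (j == i)%:Z); rewrite (bigD1 i) //= eqxx mulr1z big1 ?addr0 // => j.
by move=> /negPf ->; rewrite mulr0z.
Qed.

(** Induction on the number of generators: the coefficients of b_0 that occur in
    A form an ideal (d) of the integers; an element of A that realizes d,
    together with generators of the elements of A without b_0, generates A. The
    number of generators does not grow, which is what later makes them a
    basis. *)
Lemma subgroup_int_span k (b : 'I_k -> V) A :
  is_subgroup A -> A `<=` int_span b -> exists c : 'I_k -> V, A = int_span c.
Proof.
elim: k b A => [|k IHk] b A sA Ab.
  exists b; apply/seteqP; split=> // _ [m ->]; rewrite big_ord0; by case: sA.
pose b' i := b (lift ord0 i).
have sb' := int_span_subgroup b'.
pose I := [set m : int | exists2 v, int_span b' v & A (b ord0 *~ m + v)].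
have I0 : I 0 by exists 0; rewrite ?mulr0z ?addr0; [case: sb'|case: sA].
have IB m n : I m -> I n -> I (m - n).
  move=> [v b'v Av] [w b'w Aw]; exists (v - w); first exact: sb'.2.
  by rewrite mulrzBr addrACA -opprD; exact: sA.2.
have [d [[v b'v Av] Id]] := int_subgroup_principal I0 IB.
have [c' Ac'] := IHk b' (A `&` int_span b') (subgroupI sA sb') (@subIsetr _ _ _).
have Ac'i i : A (c' i) by have : (A `&` int_span b') (c' i);
  [rewrite Ac'; exact: int_span_gen | case].
pose c i := if unlift ord0 i is Some j then c' j else b ord0 *~ d + v.
have c0 : c ord0 = b ord0 *~ d + v by rewrite /c unlift_none.
have cS i : c (lift ord0 i) = c' i by rewrite /c liftK.
exists c; apply/seteqP; split=> [x Ax|_ [m ->]]; last first.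
  apply: subgroup_sum => // i; apply: subgroupMz => //.
  by rewrite /c; case: unliftP.
have [m xE] := Ab _ Ax; rewrite big_ord_recl in xE.
set w := \sum_(i < k) _ in xE.
have b'w : int_span b' w by exists (fun i => m (lift ord0 i)).
have [q mE] : exists q, m ord0 = d * q by apply: Id; exists w; rewrite -?xE.
have : (A `&` int_span b') (x - c ord0 *~ q).
  split; first by apply: sA.2 => //; apply: subgroupMz => //; rewrite c0.
  rewrite c0 xE mulrzDl -mulrzA -mE opprD addrACA subrr add0r.
  by apply: sb'.2 => //; exact: subgroupMz.
rewrite Ac' => -[m' x'E].
exists (fun i => if unlift ord0 i is Some j then m' j else q).
rewrite big_ord_recl unlift_none; under eq_bigr do rewrite liftK cS.
by rewrite -x'E addrC subrK.
Qed.

Lemma int_spanZ k (b : 'I_k -> V) (m : 'I_k -> int) :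
  \sum_(i < k) b i *~ m i = \sum_(i < k) (m i)%:~R *: b i.
Proof. by apply: eq_bigr => i _; rewrite scaler_int. Qed.

End Subgroups.

(** * Subgroups of finite exponent in an integral form *)

Section FiniteExponent.
Variables (C : numFieldType) (V : lmodType C).
Implicit Types (A B L U : set V).

Lemma natr_unscale (N : nat) (v : V) :
  (0 < N)%N -> N%:R^-1 *: (v *+ N) = v.
Proof.
move=> N0; rewrite -scaler_nat scalerA mulVf ?scale1r //.
by rewrite pnatr_eq0 -lt0n.
Qed.

(** The two transition matrices are square and one-sided inverses of each other,
    hence inverses, which makes the c i free. *)
Lemma spanning_basis U k (b c : 'I_k -> V) :
  is_subspace U -> is_basis U b -> (forall i, U (c i)) ->
  (forall i, exists a : 'I_k -> C, b i = \sum_(j < k) a j *: c j) ->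
  is_basis U c.
Proof.
move=> [U0 Ulin] [Ub bU bfree] Uc /choice[P bE].
have /choice[Q cE] : forall i, exists a : 'I_k -> C, c i = \sum_(j < k) a j *: b j.
  by move=> i; exact: bU.
pose M := \matrix_(i, j) P i j; pose M' := \matrix_(i, j) Q i j.
(* Combinations transform by right multiplication with the transition matrix. *)
have comp (v : 'rV[C]_k) (X : 'M[C]_k) (x y : 'I_k -> V) :
    (forall i, x i = \sum_(j < k) X i j *: y j) ->
    \sum_i v 0 i *: x i = \sum_j (v *m X) 0 j *: y j.
  move=> xE; under eq_bigr do rewrite xE scaler_sumr.
  rewrite exchange_big; apply: eq_bigr => j _.
  by rewrite mxE scaler_suml; apply: eq_bigr => i _; rewrite scalerA.
have bM i : b i = \sum_(j < k) M i j *: c j.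
  by rewrite bE; apply: eq_bigr => j _; rewrite mxE.
have cM i : c i = \sum_(j < k) M' i j *: b j.
  by rewrite cE; apply: eq_bigr => j _; rewrite mxE.
have MM' : M *m M' = 1%:M.
  apply/row_matrixP => i; apply/rowP => j; apply/eqP; rewrite -subr_eq0; apply/eqP.
  pose r : 'rV[C]_k := row i 1%:M.
  have := comp (r *m M) M' c b cM.
  rewrite -(comp r M b c bM) => E.
  have /bfree/(_ j) : \sum_j (((r *m M) *m M') 0 j - r 0 j) *: b j = 0.
    by under eq_bigr do rewrite scalerBl; rewrite sumrB -E subrr.
  by rewrite -mulmxA -row_mul mul1mx.
split=> // [v|a a0 i].
  move=> /bU[a ->]; exists (fun j => (\row_i a i *m M) 0 j).
  by rewrite -(comp _ _ _ _ bM); apply: eq_bigr => i _; rewrite mxE.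
have := comp (\row_i a i) M' c b cM.
under eq_bigr do rewrite mxE; rewrite a0 => /esym/bfree E.
have : \row_i a i = 0.
  rewrite -[LHS]mulmx1 -(mulmx1C MM') mulmxA.
  by have -> : \row_i a i *m M' = 0; [apply/rowP => j; rewrite E mxE | rewrite mul0mx].
by move=> /rowP/(_ i); rewrite !mxE.
Qed.

(** A has as many generators as the basis of L has elements, and they span U as
    soon as A contains N L. *)
Lemma integral_form_sub U L A (N : nat) :
  is_subspace U -> integral_form U L -> is_subgroup A -> A `<=` L ->
  (0 < N)%N -> (forall v, L v -> A (v *+ N)) -> integral_form U A.
Proof.
move=> sU [k [b [bU ->]]] sA AL N0 NA.
have [c Ac] := subgroup_int_span sA AL.
exists k, c; split=> //; apply: (spanning_basis sU bU) => i.
  have /AL[m ->] : A (c i) by rewrite Ac; exact: int_span_gen.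
  rewrite int_spanZ; elim/big_rec : _ => [|j v _ Uv]; first by case: sU.
  by apply: sU.2 => //; case: bU.
have := NA _ (int_span_gen b i); rewrite Ac => -[m bE].
exists (fun j => N%:R^-1 * (m j)%:~R).
rewrite -(natr_unscale (b i) N0) bE int_spanZ scaler_sumr.
by apply: eq_bigr => j _; rewrite scalerA.
Qed.

(** Every coset is represented by a combination of the basis of L with
    coefficients in {0, ..., N - 1}. *)
Lemma finite_index_sub U L A (N : nat) :
  integral_form U L -> is_subgroup A ->
  (0 < N)%N -> (forall v, L v -> A (v *+ N)) -> finite_index L A.
Proof.
move=> [k [b [_ ->]]] sA N0 NA.
pose rep (f : {ffun 'I_k -> 'I_N}) : V := \sum_i b i *~ (f i)%:Z.
apply: (@sub_finite_set _ _ ((fun f => [set rep f + w | w in A]) @` setT)); last first.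
  by apply: finite_image; exact: finite_finset.
move=> _ [_ [m ->] <-].
have Nn0 : N%:Z != 0 by rewrite eqz_nat -lt0n.
have rlt i : (`|(m i %% N%:Z)%Z| < N)%N.
  by rewrite -ltz_nat gez0_abs ?modz_ge0 //; exact: ltz_mod.
pose f : {ffun 'I_k -> 'I_N} := [ffun i => Ordinal (rlt i)].
have Adiff : A (\sum_i b i *~ m i - rep f).
  rewrite -sumrB; apply: subgroup_sum => // i.
  rewrite ffunE /= gez0_abs ?modz_ge0 // -mulrzBr {1}(divz_eq (m i) N%:Z) addrK.
  by rewrite mulrC mulrzA; apply: subgroupMz => //; apply: NA; exact: int_span_gen.
exists f => //; apply/seteqP; split=> _ [w Aw <-].
  exists (w - (\sum_i b i *~ m i - rep f)); first exact: sA.2.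
  by rewrite /= opprB addrCA [X in w + X]addrC subrK addrC.
exists (w + (\sum_i b i *~ m i - rep f)); first exact: subgroupD.
by rewrite /= addrCA [X in w + X]addrC subrK addrC.
Qed.

End FiniteExponent.

Lemma finite_common_multiple (T : eqType) (G : set T) (P : T -> nat -> Prop) :
  finite_set G ->
  (forall g, G g -> exists2 N, (0 < N)%N & P g N) ->
  (forall g m n, P g m -> P g (m * n)%N) ->
  exists2 N, (0 < N)%N & forall g, G g -> P g N.
Proof.
move=> /finite_seqP[s ->] exN PM.
suff [N N0 NP] : exists2 N, (0 < N)%N & forall g, g \in s -> P g N by exists N.
elim: s exN => [|g s IHs] exN; first by exists 1%N.
have [N N0 NP] : exists2 N, (0 < N)%N & forall g, g \in s -> P g N.
  by apply: IHs => h /= hs; apply: exN; rewrite /= inE hs orbT.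
have [M M0 MP] := exN g (mem_head _ _).
exists (M * N)%N; first by rewrite muln_gt0 M0.
move=> h; rewrite inE => /predU1P[->|/NP]; first exact: PM.
by rewrite mulnC; exact: PM.
Qed.

(** * Rational structures on complex vector spaces *)

Section RationalStructure.
Variables (C : numFieldType) (V : lmodType C).
Implicit Types (A B U : set V).

Definition is_rat_subspace A : Prop :=
  A 0 /\ forall (q : rat) u v, A u -> A v -> A (ratr q *: u + v).

(** For a subgroup A, this is the rational span of A: clearing denominators
    replaces rational combinations by a single multiplier. *)
Definition divisible_hull A : set V :=
  [set v | exists2 N : nat, (0 < N)%N & A (v *+ N)].

Definition complex_span A : set V :=
  [set v | exists s : seq (C * V),
     (forall p, p \in s -> A p.2) /\ v = \sum_(p <- s) p.1 *: p.2].

Lemma rat_subspaceI A U :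
  is_rat_subspace A -> is_subspace U -> is_rat_subspace (A `&` U).
Proof.
move=> [A0 AP] [U0 UP]; split=> // q u v [Au Uu] [Av Uv].
by split; [exact: AP | exact: UP].
Qed.

Lemma rat_subspaceZ A (q : rat) u :
  is_rat_subspace A -> A u -> A (ratr q *: u).
Proof. by move=> [A0 AP] Au; rewrite -[_ *: u]addr0; exact: AP. Qed.

Lemma rat_subspaceB A u v : is_rat_subspace A -> A u -> A v -> A (u - v).
Proof.
by move=> [A0 AP] Au Av; rewrite addrC -scaleN1r -(rmorphN1 (@ratr C)); exact: AP.
Qed.

Lemma rat_span_min A B : is_rat_subspace B -> A `<=` B -> rat_span A `<=` B.
Proof.
move=> [B0 BP] AB _ [k [b [q [Ab ->]]]].
by elim/big_rec : _ => // i v _ Bv; apply: BP => //; exact: AB.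
Qed.

Lemma sub_divisible_hull A : A `<=` divisible_hull A.
Proof. by move=> v Av; exists 1%N. Qed.

Lemma divisible_hull_rat A : is_subgroup A -> is_rat_subspace (divisible_hull A).
Proof.
move=> sA; split; first by apply: sub_divisible_hull; case: sA.
move=> q u v [M M0 Au] [N N0 Av].
pose D := `|denq q|%N; have D0 : (0 < D)%N by rewrite absz_gt0 denq_neq0.
have qD : ratr q * D%:R = (numq q)%:~R :> C.
  rewrite pmulrn absz_denq mulfVK // intr_eq0; exact: denq_neq0.
exists (D * M * N)%N; first by rewrite !muln_gt0 D0 M0.
have -> : (ratr q *: u + v) *+ (D * M * N) =
    u *+ M *~ numq q *+ N + v *+ N *+ (D * M).
  rewrite mulrnDl -[v *+ N *+ _]mulrnA [(N * _)%N]mulnC; congr (_ + _).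
  rewrite !mulrnA; congr (_ *+ _).
  by rewrite -[_ *: u *+ D]scaler_nat scalerA mulrC qD scaler_int !pmulrn mulrzAC.
apply: subgroupD => //; last exact: subgroupMn.
by apply: subgroupMn => //; exact: subgroupMz.
Qed.

Lemma complex_span_subspace A : is_subspace (complex_span A).
Proof.
split; first by exists [::]; rewrite big_nil.
move=> a _ _ [s [sA ->]] [t [tA ->]].
exists ([seq (a * p.1, p.2) | p <- s] ++ t); split.
  by move=> p; rewrite mem_cat => /orP[/mapP[p' /sA ? ->]|/tA].
rewrite big_cat big_map scaler_sumr; congr (_ + _).
by apply: eq_bigr => p _; rewrite scalerA.
Qed.

Lemma sub_complex_span A : A `<=` complex_span A.
Proof.
move=> v Av; exists [:: (1, v)]; rewrite big_seq1 scale1r; split=> // p.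
by rewrite inE => /eqP ->.
Qed.

Lemma complex_span_min A U : is_subspace U -> A `<=` U -> complex_span A `<=` U.
Proof.
move=> [U0 UP] AU _ [s [sA ->]]; rewrite big_seq.
by elim/big_rec : _ => // p v /sA/AU Up Uv; exact: UP.
Qed.

Lemma divisible_hull_int_span k (b : 'I_k -> V) v :
  divisible_hull (int_span b) v ->
  exists q : 'rV[rat]_k, v = \sum_(i < k) ratr (q 0 i) *: b i.
Proof.
move=> [N N0 [m vE]]; exists (\row_i ((m i)%:~R / N%:R)).
rewrite -(natr_unscale v N0) vE int_spanZ scaler_sumr.
apply: eq_bigr => i _; rewrite scalerA mxE fmorph_div rmorph_int rmorph_nat.
by rewrite mulrC.
Qed.

(** Solvability of a linear system with rational coefficients does not depend on
    the field in which solutions are sought. *)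
Lemma rational_descent U k (b : 'I_k -> V) A x :
  is_basis U b -> is_rat_subspace A -> A `<=` divisible_hull (int_span b) ->
  divisible_hull (int_span b) x -> complex_span A x -> A x.
Proof.
move=> [_ _ bfree] ratA Ab /divisible_hull_int_span[m xE] [s [sA xs]].
pose w (j : 'I_(size s)) := (tnth (in_tuple s) j).2.
pose c : 'rV[C]_(size s) := \row_j (tnth (in_tuple s) j).1.
have Aw j : A (w j) by apply: sA; exact: mem_tnth.
have /choice[Q wE] : forall j, exists q : 'rV[rat]_k,
    w j = \sum_(i < k) ratr (q 0 i) *: b i.
  by move=> j; exact/divisible_hull_int_span/Ab.
pose M := \matrix_j Q j.
have xcM : x = \sum_i (c *m map_mx ratr M) 0 i *: b i.
  rewrite xs big_tnth; under eq_bigr do rewrite -/(w _) wE scaler_sumr.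
  rewrite exchange_big; apply: eq_bigr => i _; rewrite mxE scaler_suml.
  by apply: eq_bigr => j _; rewrite scalerA !mxE.
have mcM : map_mx ratr m = c *m map_mx ratr M.
  apply/rowP => i; apply/eqP; rewrite -subr_eq0; apply/eqP.
  move: i; apply: (bfree (fun i => (map_mx ratr m) 0 i - (c *m map_mx ratr M) 0 i)).
  under eq_bigr do rewrite scalerBl mxE; rewrite sumrB -xE -xcM subrr //.
have /submxP[D mE] : (m <= M)%MS.
  by rewrite -(map_submx (@ratr C)) mcM submxMl.
have -> : x = \sum_j ratr (D 0 j) *: w j.
  rewrite xE mE; under [RHS]eq_bigr do rewrite wE scaler_sumr.
  rewrite exchange_big; apply: eq_bigr => i _; rewrite mxE rmorph_sum scaler_suml.
  by apply: eq_bigr => j _; rewrite scalerA rmorphM /= [M _ _]mxE.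
by elim/big_rec : _ => [|j v _ Av]; [case: ratA | apply: ratA.2].
Qed.

End RationalStructure.

(** * Weight components through L(0) *)

Section VOA.
Variables (K : realType) (V : voa K).
Implicit Types (A R W : set V) (G : set (V -> V)) (g : V -> V) (u v : V).

(** The product, over the m in s other than n, of (L(0) - m) / (n - m), where
    L(0) is mode 1 of the conformal vector. *)
Definition sieve (n : int) (s : seq int) (v : V) : V :=
  foldr (fun m u => if m == n then u
           else (n - m)%:~R^-1 *: (mode 1 (conf V) u - m%:~R *: u)) v s.

Lemma sieve_linear n s : linear (sieve n s).
Proof.
move=> a u v; elim: s => //= m s ->; case: ifP => // _.
rewrite linearDr linearZr_LR /= [m%:~R *: _]scalerDr opprD addrACA scalerDr; congr (_ + _).
by rewrite [_ *: (a *: _)]scalerA [_ * a]mulrC -scalerA -scalerBr !scalerA mulrC.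
Qed.

HB.instance Definition _ n s :=
  GRing.isLinear.Build K[i]%C V V _ (sieve n s) (sieve_linear n s).

Lemma sieve_eigen m n s u : grade V m u ->
  sieve n s u = (\prod_(l <- s | l != n) ((m - l)%:~R / (n - l)%:~R)) *: u.
Proof.
move=> Vu; elim: s => [|l s IHs] /=; first by rewrite big_nil scale1r.
rewrite big_cons IHs; case: (l == n) => //=.
rewrite linearZr_LR /= (L0_grade Vu) !scalerA [_ * m%:~R]mulrC -scalerBl scalerA.
by rewrite -mulrBl mulrA -intrB [_^-1 * _]mulrC.
Qed.

Lemma sieve_id n s u : grade V n u -> sieve n s u = u.
Proof.
move=> Vu; rewrite (sieve_eigen _ _ Vu) big1 ?scale1r // => l ln.
by rewrite mulfV // intr_eq0 subr_eq0 eq_sym.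
Qed.

Lemma sieve_kill m n s u : grade V m u -> m != n -> m \in s -> sieve n s u = 0.
Proof.
move=> Vu mn ms; rewrite (sieve_eigen _ _ Vu) (big_rem m) //= mn subrr.
by rewrite !mul0r scale0r.
Qed.

(** Once s contains all weights that occur in v, the operator extracts the
    component of v of weight n.  The statement covers all larger t, so that
    finitely many vectors can share one list of weights. *)
Lemma sieve_grade v n :
  exists s : seq int, forall t : seq int, {subset s <= t} -> grade V n (sieve n t v).
Proof.
have [x [[xV /finite_seqP[s sE] vE] _]] := grade_direct v.
have s0 i : i \notin s -> x i = 0.
  move=> is_; apply: contrapT => xi; move: is_.
  by have : [set n | x n <> 0] i by []; rewrite sE /= => ->.
exists s => t st.
have V0 : grade V n 0 by case: (grade_subspace V n).
have VD u w : grade V n u -> grade V n w -> grade V n (u + w).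
  by move=> Vu Vw; rewrite -[u]scale1r; exact: (grade_subspace V n).2.
have {vE} -> : v = \sum_(i <- undup s) x i.
  rewrite {}vE (@fsbigE _ _ _ _ _ (undup s)) ?undup_uniq //.
    by apply: eq_bigl => i; rewrite in_setT.
  by move=> i _; rewrite mem_undup => /s0.
rewrite linear_sum big_seq /=.
elim/big_rec : _ => // i w; rewrite mem_undup => /st it Vw; apply: VD => //.
have [<-|ni] := eqVneq i n; first by rewrite (sieve_id _ (xV i)).
by rewrite (sieve_kill (xV i) ni it).
Qed.

(** * The complex span of a rational vertex algebra *)

Lemma complex_span_mode W : mode_closed W -> mode_closed (complex_span W).
Proof.
move=> Wmode n u v uW; move: v.
have [S0 SP] := complex_span_subspace W.
have mode_sub (x : V) : is_subspace [set v | complex_span W (mode n x v)].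
  split=> [|a y z yS zS] /=; first by rewrite linear0r.
  by rewrite linearDr linearZr_LR; exact: SP.
apply: complex_span_min (mode_sub u) _ => v Wv; move: u uW; apply: complex_span_min.
  split=> [|a y z yS zS] /=; first by rewrite linear0l.
  by rewrite linearDl linearZl_LR; exact: SP.
by move=> u Wu; apply: sub_complex_span; exact: Wmode.
Qed.

(** The interpolation operators have rational coefficients, so they preserve W
    and bring its elements into W_n, while they fix x. *)
Lemma graded_part_span W n x :
  is_rat_subspace W -> W (conf V) -> mode_closed W ->
  complex_span W x -> grade V n x -> complex_span (graded_part W n) x.
Proof.
move=> ratW Wconf Wmode xW xn.
have Wsieve t v : W v -> W (sieve n t v).
  move=> Wv; elim: t => //= m t IHt; case: ifP => // _.
  rewrite -ratr_int -fmorphV; apply: rat_subspaceZ => //.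
  rewrite -ratr_int; apply: rat_subspaceB => //; first exact: Wmode.
  exact: rat_subspaceZ.
have [S0 SP] := complex_span_subspace (graded_part W n).
pose Z := [set v | exists s : seq int, forall t : seq int, {subset s <= t} ->
  complex_span (graded_part W n) (sieve n t v)].
(* Z consists of the vectors whose component of weight n is in the span. *)
have subZ : is_subspace Z.
  split.
    by exists [::] => t _; rewrite linear0.
  move=> a u v [s us] [s' vs]; exists (s ++ s') => t st.
  rewrite linearP; apply: SP.
    by apply: us => m ms; apply: st; rewrite mem_cat ms.
  by apply: vs => m ms; apply: st; rewrite mem_cat ms orbT.
have [s /(_ s)] : Z x.
  move: x xW {xn}; apply: complex_span_min => // v Wv.
  have [s vs] := sieve_grade v n; exists s => t st.
  by apply: sub_complex_span; split; [exact: Wsieve | exact: vs].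
by rewrite sieve_id //; apply.
Qed.

Lemma divisible_hull_mode R :
  is_subgroup R -> mode_closed R -> mode_closed (divisible_hull R).
Proof.
move=> sR Rmode n u v [M M0 Ru] [N N0 Rv]; exists (M * N)%N; first by rewrite muln_gt0 M0.
by rewrite mulrnA -linearMnl -linearMnr; exact: Rmode.
Qed.

(** * Intersecting the translates under a finite group *)

(** As G is closed under inverses, this is the intersection of the images of A
    under the elements of G, and the largest G-invariant subset of A. *)
Definition invariant_core G A : set V := [set v | forall g, G g -> A (g v)].

Lemma aut0 g : is_voa_aut g -> g 0 = 0.
Proof.
move=> /aut_linear glin; apply: (@addrI _ (g 0)).
by rewrite addr0 -{1}[g 0]scale1r -glin scale1r addr0.
Qed.

Lemma autZ g a v : is_voa_aut g -> g (a *: v) = a *: g v.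
Proof.
by move=> gA; rewrite -[a *: v]addr0 (aut_linear gA) (aut0 gA) addr0.
Qed.

Lemma autB g u v : is_voa_aut g -> g (u - v) = g u - g v.
Proof.
by move=> gA; rewrite addrC -scaleN1r (aut_linear gA) scaleN1r addrC.
Qed.

Lemma autMn g v N : is_voa_aut g -> g (v *+ N) = g v *+ N.
Proof. by move=> gA; rewrite -scaler_nat (autZ _ _ gA) scaler_nat. Qed.

Section Core.
Variable G : set (V -> V).
Hypothesis finG : is_finite_aut_subgroup G.

Lemma core_sub A : invariant_core G A `<=` A.
Proof. by move=> v; apply; exact: autg_id finG. Qed.

Lemma core_invariant A : invariant_under G (invariant_core G A).
Proof.
by move=> g Gg _ [v vA <-] h Gh; apply: (vA (h \o g)); exact: autg_comp finG _ _ _ _.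
Qed.

Lemma core_subgroup A : is_subgroup A -> is_subgroup (invariant_core G A).
Proof.
move=> [A0 AB]; split=> [g Gg|u v uA vA g Gg].
  by rewrite (aut0 (autg_aut finG Gg)).
by rewrite (autB _ _ (autg_aut finG Gg)); apply: AB; auto.
Qed.

Lemma core_rat_subspace A : is_rat_subspace A -> is_rat_subspace (invariant_core G A).
Proof.
move=> [A0 AP]; split=> [g Gg|q u v uA vA g Gg].
  by rewrite (aut0 (autg_aut finG Gg)).
by rewrite (aut_linear (autg_aut finG Gg)); apply: AP; auto.
Qed.

Lemma core_mode A : mode_closed A -> mode_closed (invariant_core G A).
Proof.
move=> Am n u v uA vA g Gg.
by rewrite (aut_mode (autg_aut finG Gg)); apply: Am; auto.
Qed.

Lemma core_vac A : A (vac V) -> invariant_core G A (vac V).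
Proof. by move=> A1 g Gg; rewrite (aut_vac (autg_aut finG Gg)). Qed.

Lemma core_conf A : A (conf V) -> invariant_core G A (conf V).
Proof. by move=> A1 g Gg; rewrite (aut_conf (autg_aut finG Gg)). Qed.

Lemma core_confMn A s : A (conf V *+ s) -> invariant_core G A (conf V *+ s).
Proof.
move=> A1 g Gg.
by rewrite (autMn _ _ (autg_aut finG Gg)) (aut_conf (autg_aut finG Gg)).
Qed.

(** A common multiple of the denominators of g (b i), over the finitely many g
    in G and the basis vectors b i of R_n. *)
Lemma graded_part_core_exponent R n :
  is_subgroup R -> integral_form (grade V n) (graded_part R n) ->
  graded_part R n `<=` invariant_core G (divisible_hull R) ->
  exists2 N, (0 < N)%N &
    forall v, graded_part R n v -> graded_part (invariant_core G R) n (v *+ N).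
Proof.
move=> sR [k [b [[Vb _ _] RnE]]] RnW.
have Rnb i : graded_part R n (b i) by rewrite RnE; exact: int_span_gen.
pose P (g : V -> V) N := forall i, R (g (b i) *+ N).
have [N N0 NP] : exists2 N, (0 < N)%N & forall g, G g -> P g N.
  apply: (@finite_common_multiple (V -> V)).
  - exact: autg_finite finG.
  - move=> g Gg.
    have [N N0 NP] : exists2 N, (0 < N)%N &
        forall i, [set: 'I_k] i -> R (g (b i) *+ N).
      apply: finite_common_multiple => [|i _|i p q Rp].
      + exact: finite_finset.
      + exact: RnW (Rnb i) _ Gg.
      + by rewrite mulrnA; exact: subgroupMn.
    by exists N => // i; exact: NP.
  - by move=> g p q Pp i; rewrite mulrnA; apply: subgroupMn => //; exact: Pp.
exists N => // v Rv; have [_ Vv] := Rv; split; last first.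
  have [V0 VP] := grade_subspace V n.
  by rewrite -[_ *+ N]scaler_nat -[_ *: _]addr0; exact: VP.
move: Rv; rewrite RnE => -[m vE].
have sS := core_subgroup sR; rewrite vE -sumrMnl.
apply: (subgroup_sum sS) => i; rewrite pmulrn mulrzAC -pmulrn.
apply: (subgroupMz (m i) sS) => g Gg.
by rewrite (autMn _ _ (autg_aut finG Gg)); exact: NP.
Qed.

End Core.
End VOA.

Theorem theorem2p5 (K : realType) (V : voa K) (form : {symmetric V})
    (R : set V) (d : nat) (G : set (V -> V)) :
  nondegenerate_form form ->
  is_ivoa form R ->
  generated_by (low_part R d) ->
  is_finite_aut_subgroup G ->
  invariant_under G (rat_span (low_part R d)) ->
  exists S : set V,
    [/\ is_ivoa form S,
        S `<=` R,
        forall n : int, finite_index (graded_part R n) (graded_part S n)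
      & invariant_under G S].
Proof.
move=> _ [sR R1 Rmode [s [s0 Rconf]] Rint Rrat] genR finG invG.
set B := divisible_hull R; pose W := invariant_core G B.
have ratB : is_rat_subspace B by exact: divisible_hull_rat.
have ratW : is_rat_subspace W by exact: core_rat_subspace.
have Wmode : mode_closed W := core_mode finG (divisible_hull_mode sR Rmode).
have lowW : low_part R d `<=` W.
  move=> v vlow g Gg.
  have lowB : low_part R d `<=` B.
    move=> _ [r [rR ->]]; apply: sub_divisible_hull.
    by apply: subgroup_sum => // i; case: (rR i).
  apply: (rat_span_min ratB lowB); apply: (invG _ Gg); exists v => //.
  exists 1%N, (fun=> v), (fun=> 1); split=> //.
  by rewrite big_ord1 rmorph1 scale1r.
have spanW : complex_span W = [set: V].
  apply: genR.
  - exact: complex_span_subspace.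
  - exact: sub_complex_span (core_vac finG (sub_divisible_hull R1)).
  - exact: complex_span_mode.
  - exact: subset_trans lowW (@sub_complex_span _ _ _).
have sRn n : is_subgroup (grade V n).
  have [V0 VP] := grade_subspace V n; split=> // u v Vu Vv.
  by rewrite addrC -scaleN1r; exact: VP.
have RnW n : graded_part R n `<=` W.
  move=> x Rx; have [k [b [bV RnE]]] := Rint n.
  (* Descent has to run inside V_n, where R supplies a basis, so W is replaced
     by its part of weight n. *)
  suff [] : graded_part W n x by [].
  have hullRn v : B v -> grade V n v -> divisible_hull (graded_part R n) v.
    move=> [N N0 Rv] Vv; exists N => //; split=> //; exact: subgroupMn.
  apply: (rational_descent bV).
  - exact: rat_subspaceI ratW (grade_subspace V n).
  - by move=> v [Wv Vv]; rewrite -RnE; apply: hullRn => //; exact: core_sub Wv.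
  - by rewrite -RnE; exact: sub_divisible_hull.
  - apply: graded_part_span => //; [|by rewrite spanW|by case: Rx].
    by apply: (core_conf finG); exists s.
pose S := invariant_core G R.
have sS : is_subgroup S by exact: core_subgroup.
have SR : S `<=` R by exact: core_sub.
have sSn n : is_subgroup (graded_part S n) by exact: subgroupI.
have expo n := graded_part_core_exponent finG sR (Rint n) (@RnW n).
exists S; split=> //.
- split=> //.
  + exact: core_vac.
  + exact: core_mode.
  + by exists s; split=> //; exact: core_confMn.
  + move=> n; have [N N0 NP] := expo n.
    apply: (integral_form_sub (grade_subspace V n) (Rint n)) N0 NP => //.
    by move=> v [Sv Vv]; split=> //; exact: SR.
  + by move=> u v Su Sv; apply: Rrat; exact: SR.
- by move=> n; have [N N0 NP] := expo n; exact: finite_index_sub (Rint n) _ N0 NP.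
- exact: core_invariant.
Qed.
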